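(* Let $n\geq 2$, let $\Omega\subset\mathbb{R}^n$ be an open set of finite positive measure $V=|\Omega|$, let $\lambda_1\leq\lambda_2\leq\cdots$ be its Dirichlet eigenvalues and $\{\phi_j\}_{j\geq 1}$ a real-valued $L^2(\Omega)$-orthonormal basis of corresponding Dirichlet eigenfunctions. For every integer $k\geq 1$ and almost every $\xi\in\mathbb{R}^n$, \[ F_k(\xi)\leq\frac{V}{(2\pi)^n}\min\left\{1,\frac{\lambda_k}{|\xi|^2}\right\}, \] where only the first term of the minimum is used at $\xi=0$.
   Context: The eigenvalues $0<\lambda_1\leq\lambda_2\leq\cdots\nearrow\infty$ of the Dirichlet Laplacian on $\Omega$ are listed in nondecreasing order with multiplicity; the eigenfunctions satisfy $\phi_j\in H_0^1(\Omega)$, $-\Delta\phi_j=\lambda_j\phi_j$ (weakly), and $\int_\Omega\phi_i\phi_j\,\mathrm{d}x=\delta_{ij}$. The Fourier transform is unitary: \[ \widehat{u}(\xi)=(2\pi)^{-n/2}\int_{\mathbb{R}^n}u(x)e^{-\mathrm{i}x\cdot\xi}\,\mathrm{d}x, \] and functions in $H_0^1(\Omega)$ are extended by zero to $\mathbb{R}^n$. The Fourier density of the first $k$ eigenfunctions is \[ F_k(\xi)=\sum_{j=1}^k|\widehat{\phi_j}(\xi)|^2. \] *)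

(* Defs.v *)
From HB Require Import structures.
From mathcomp Require Import all_boot all_order all_algebra.
From mathcomp Require Import complex.
From mathcomp Require Import all_classical all_reals all_analysis.

Set Implicit Arguments.
Unset Strict Implicit.
Unset Printing Implicit Defensive.

Import Order.TTheory GRing.Theory Num.Theory.
Import numFieldNormedType.Exports.

Local Open Scope classical_set_scope.
Local Open Scope ring_scope.

(* R^n is 'rV[R]_n. Its sigma-algebra is generated by the coordinates (as for
   n.-tuple in the library); it is the Borel sigma-algebra, see
   open_measurable_rV below. *)
Definition rV_display : measure_display.
Proof. exact: default_measure_display. Qed.

Section measurable_rV.
Context {R : realType} {n : nat}.

Let coor : 'I_n -> 'rV[R]_n -> R := fun i x => x ord0 i.

Let rV_set0 : g_sigma_preimage coor set0.
Proof. exact: sigma_algebra0. Qed.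

Let rV_setC A : g_sigma_preimage coor A -> g_sigma_preimage coor (~` A).
Proof. exact: sigma_algebraC. Qed.

Let rV_bigcup (F : _^nat) : (forall i, g_sigma_preimage coor (F i)) ->
  g_sigma_preimage coor (\bigcup_i (F i)).
Proof. exact: sigma_algebra_bigcup. Qed.

HB.instance Definition _ := @isMeasurable.Build rV_display
  'rV[R]_n (g_sigma_preimage coor) rV_set0 rV_setC rV_bigcup.

End measurable_rV.

Lemma measurable_coor (R : realType) n (i : 'I_n) :
  measurable_fun [set: 'rV[R]_n] (fun x : 'rV[R]_n => x ord0 i).
Proof.
move=> _ Y mY; rewrite setTI; apply: sub_sigma_algebra => /=.
rewrite -bigcup_seq/=; exists i => /=; first by rewrite mem_index_enum.
by exists Y => //; rewrite setTI.
Qed.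

Lemma measurable_fun_coorP (R : realType) d (T : measurableType d) n
    (f : T -> 'rV[R]_n) :
  (forall i, measurable_fun [set: T] (fun x => f x ord0 i)) ->
  measurable_fun [set: T] f.
Proof.
move=> mf.
have H : g_sigma_preimage (fun i => (fun x : 'rV[R]_n => x ord0 i) \o f)
    `<=` measurable.
  apply: smallest_sub; first exact: sigma_algebra_measurable.
  case: n => [|n] in f mf *; first by rewrite big_ord0.
  rewrite -bigcup_mkord_ord; apply: bigcup_sub => i Ii.
  by move=> A [B mB <-]; exact: mf.
by move=> _ A mA; apply: H; rewrite g_sigma_preimage_comp; exists A.
Qed.

(* Rational boxes form a countable base of the topology. *)
Lemma open_measurable_rV (R : realType) n (A : set 'rV[R]_n) :
  open A -> measurable A.
Proof.
move=> oA.
pose B (p : 'rV[rat]_n * rat) : set 'rV[R]_n :=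
  \big[setI/setT]_(i < n) ((fun x : 'rV[R]_n => x ord0 i) @^-1`
    (ball (ratr (p.1 ord0 i) : R) (ratr p.2))).
have mB p : measurable (B p).
  apply: bigsetI_measurable => i _.
  rewrite -[X in measurable X]setTI.
  by apply: measurable_coor => //; rewrite ball_itv; exact: measurable_itv.
have -> : A = \bigcup_(p in [set p | B p `<=` A]) B p.
  apply/seteqP; split=> [x Ax|x [p Bp]]; last exact: Bp.
  have /nbhs_ballP[e /= e0 eA] : nbhs x A by apply: open_nbhs_nbhs; split.
  have [q /andP[q0 qe]] : exists q : rat, (0 : R) < ratr q < e / 2.
    by have [q] := rat_in_itvoo (divr_gt0 e0 (ltr0n R 2)); rewrite in_itv/=; exists q.
  have /choice[r rP] : forall i : 'I_n, exists r : rat,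
      `|x ord0 i - ratr r| < (ratr q : R).
    move=> i; have : x ord0 i - (ratr q : R) < x ord0 i + ratr q.
      by rewrite ltrBlDr -addrA ltrDl addr_gt0.
    move=> /rat_in_itvoo[r]; rewrite in_itv/= => /andP[h1 h2]; exists r.
    by rewrite ltr_distlC; apply/andP; split.
  have BE y : B (\row_i r i, q) y <->
      forall i, `|ratr (r i) - y ord0 i| < (ratr q : R).
    rewrite /B -bigcap_seq /=; split=> [h i|h i _].
      by have := h i (mem_index_enum i); rewrite /= mxE.
    by rewrite /= mxE; exact: h.
  exists (\row_i r i, q).
    move=> y /BE yB; apply: eA; split => //= i j; rewrite (ord1 i).
    rewrite -ball_normE /= -(subrKA (ratr (r j))).
    rewrite (le_lt_trans (ler_normD _ _)) // (splitr e).
    by apply: ltrD; apply: lt_trans qe; [exact: rP|exact: yB].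
  by apply/BE => i; rewrite distrC.
rewrite bigcup_mkcond; apply: countable_bigcupT_measurable => // p.
by case: ifP => _; [exact: mB|exact: measurable0].
Qed.

(* Lebesgue measure on R^n, as the n-fold product of lebesgue_measure: the image
   of lebesgue_measure \x (Lebesgue measure on R^n) by (a, x) |-> (a, x_0, x_1,
   ...), starting from the unit mass on the one-point space R^0. *)
Section lebesgue_rV_step.
Context {R : realType} {n : nat}.

Definition rV_cons (p : R * 'rV[R]_n) : 'rV[R]_n.+1 :=
  \row_i oapp (p.2 ord0) p.1 (unlift ord0 i).

Definition rV_uncons (x : 'rV[R]_n.+1) : R * 'rV[R]_n :=
  (x ord0 ord0, \row_i x ord0 (lift ord0 i)).

Lemma rV_consK : cancel rV_cons rV_uncons.
Proof.
case=> a x; rewrite /rV_cons /rV_uncons mxE unlift_none /=; congr pair.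
by apply/rowP => i; rewrite !mxE liftK.
Qed.

Lemma rV_unconsK : cancel rV_uncons rV_cons.
Proof.
by move=> x; apply/rowP => i; rewrite !mxE; case: unliftP => [j ->|->] /=; rewrite ?mxE.
Qed.

Lemma measurable_rV_cons : measurable_fun [set: R * 'rV[R]_n] rV_cons.
Proof.
apply: measurable_fun_coorP => i; rewrite /rV_cons.
under eq_fun do rewrite mxE.
case: unliftP => [j _|_] /=; last exact: measurable_fst.
by apply: (measurableT_comp (measurable_coor j)); exact: measurable_snd.
Qed.

Lemma measurable_rV_uncons : measurable_fun [set: 'rV[R]_n.+1] rV_uncons.
Proof.
apply/measurable_fun_pair; first exact: measurable_coor.
apply: measurable_fun_coorP => i /=.
by under eq_fun do rewrite mxE; exact: measurable_coor.
Qed.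

Variable m : {sigma_finite_measure set 'rV[R]_n -> \bar R}.

Definition lebesgue_rV_step : set 'rV[R]_n.+1 -> \bar R :=
  pushforward ((@lebesgue_measure R) \x m)%E rV_cons.

Let step0 : lebesgue_rV_step set0 = 0%E.
Proof. by rewrite /lebesgue_rV_step /pushforward preimage_set0 measure0. Qed.

Let step_ge0 A : (0 <= lebesgue_rV_step A)%E.
Proof. by rewrite /lebesgue_rV_step /pushforward. Qed.

Let step_sigma_additive : semi_sigma_additive lebesgue_rV_step.
Proof.
move=> F mF tF mUF; rewrite /lebesgue_rV_step /pushforward preimage_bigcup.
have mpre A : measurable A -> measurable (rV_cons @^-1` A).
  by move=> mA; rewrite -[X in measurable X]setTI; exact: measurable_rV_cons.
apply: measure_semi_sigma_additive.
- by move=> k; exact: mpre.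
- by move=> i j _ _ [x [/= Fi Fj]]; apply: tF => //; exists (rV_cons x).
- by rewrite -preimage_bigcup; exact: mpre.
Qed.

HB.instance Definition _ := isMeasure.Build _ _ _ lebesgue_rV_step
  step0 step_ge0 step_sigma_additive.

Let step_sigma_finite : sigma_finite setT lebesgue_rV_step.
Proof.
have /sigma_finiteP[F [TF ndF Foo]] := sigma_finiteT (@lebesgue_measure R).
have /sigma_finiteP[G [TG ndG Goo]] := sigma_finiteT m.
exists (fun k => rV_uncons @^-1` (F k `*` G k)).
  rewrite -preimage_bigcup -[LHS](preimage_setT rV_uncons); congr (_ @^-1` _).
  apply/seteqP; split=> -[x y] // _.
  have [k _ Fkx] : (\bigcup_k F k) x by rewrite -TF.
  have [l _ Gly] : (\bigcup_k G k) y by rewrite -TG.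
  exists (maxn k l) => //; split => /=.
    by move: x Fkx; exact/subsetPset/ndF/leq_maxl.
  by move: y Gly; exact/subsetPset/ndG/leq_maxr.
move=> k; have [mF Fk] := Foo k; have [mG Gk] := Goo k; split.
  rewrite -[X in measurable X]setTI.
  by apply: measurable_rV_uncons => //; exact: measurableX.
rewrite /lebesgue_rV_step /pushforward -comp_preimage.
have -> : rV_uncons \o rV_cons = id by apply/funext => x /=; rewrite rV_consK.
by rewrite preimage_id product_measure1E// lte_mul_pinfty// ge0_fin_numE.
Qed.

HB.instance Definition _ := Measure_isSigmaFinite.Build _ _ _ lebesgue_rV_step
  step_sigma_finite.

End lebesgue_rV_step.

Fixpoint lebesgue_rV (R : realType) (n : nat) :
    {sigma_finite_measure set 'rV[R]_n -> \bar R} :=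
  match n with
  | 0%N => dirac (0 : 'rV[R]_0)
  | n'.+1 => lebesgue_rV_step (lebesgue_rV R n')
  end.

Lemma lebesgue_rV_box (R : realType) n (a b : 'rV[R]_n) :
  (forall i, a ord0 i <= b ord0 i) ->
  lebesgue_rV R n
    [set x : 'rV[R]_n | forall i, a ord0 i <= x ord0 i <= b ord0 i] =
  (\prod_(i < n) (b ord0 i - a ord0 i))%:E.
Proof.
elim: n a b => [|n IH] a b ab.
  rewrite big_ord0 /= diracE mem_set// => -[] //.
rewrite big_ord_recl.
pose a' := (rV_uncons a).2; pose b' := (rV_uncons b).2.
have mcoor i : measurable ([set x : 'rV[R]_n | a' ord0 i <= x ord0 i <= b' ord0 i]).
  rewrite -[X in measurable X]setTI.
  have := @measurable_coor R n i measurableT _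
    (measurable_itv `[a' ord0 i, b' ord0 i]).
  by congr (measurable (_ `&` _)); apply/seteqP; split=> x /=; rewrite in_itv.
have -> : lebesgue_rV R n.+1
    [set x : 'rV[R]_n.+1 | forall i, a ord0 i <= x ord0 i <= b ord0 i] =
  ((@lebesgue_measure R) \x lebesgue_rV R n)%E (`[a ord0 ord0, b ord0 ord0] `*`
     [set x : 'rV[R]_n | forall i, a' ord0 i <= x ord0 i <= b' ord0 i]).
  rewrite /= /lebesgue_rV_step /pushforward; congr (product_measure1 _ _ _).
  apply/seteqP; split=> -[t x] /=; rewrite in_itv /=.
    move=> h; split; first by have := h ord0; rewrite mxE unlift_none.
    by move=> i; have := h (lift ord0 i); rewrite !mxE liftK.
  move=> [h0 h] i; rewrite mxE; case: unliftP => [j ->|->] //=.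
  by have := h j; rewrite !mxE.
rewrite product_measure1E //; last first.
  rewrite (_ : [set x | _] = \big[setI/setT]_(i < n)
     [set x : 'rV[R]_n | a' ord0 i <= x ord0 i <= b' ord0 i]).
    by apply: bigsetI_measurable.
  rewrite -bigcap_seq; apply/seteqP; split=> [x h i _|x h i]; first exact: h.
  exact: h i (mem_index_enum i).
have -> := IH a' b' _; last by move=> i; rewrite !mxE.
rewrite [X in (X * _)%E](_ : _ = (b ord0 ord0 - a ord0 ord0)%:E); last first.
  have /= -> := @lebesgue_measure_itv R `[a ord0 ord0, b ord0 ord0].
  rewrite lte_fin; have := ab ord0; rewrite le_eqVlt => /orP[/eqP ->|->] //.
  by rewrite ltxx subrr.
by rewrite -EFinM; congr (_ * _)%:E; apply: eq_bigr => i _; rewrite !mxE.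
Qed.

Section sobolev.
Context {R : realType} {n : nat}.
Implicit Types (Omega : set 'rV[R]_n) (u v : 'rV[R]_n -> R)
  (G : 'I_n -> 'rV[R]_n -> R) (x y xi : 'rV[R]_n).

Local Notation mu := (lebesgue_rV R n).

(* The norm `|x| on 'rV[R]_n is the sup norm, hence enorm. *)
Definition dot x y : R := \sum_(i < n) x ord0 i * y ord0 i.
Definition enorm x : R := Num.sqrt (dot x x).

Definition partial (i : 'I_n) u : 'rV[R]_n -> R :=
  fun x => 'D_(delta_mx ord0 i) u x.

Fixpoint Ck (k : nat) u : Prop :=
  continuous u /\
  if k is k'.+1 then
    forall i : 'I_n, (forall x, derivable u x (delta_mx ord0 i)) /\
                     Ck k' (partial i u)
  else True.

Definition smooth u := forall k, Ck k u.

Definition tsupport u : set 'rV[R]_n := closure [set x | u x != 0].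

(* C_c^oo(Omega) *)
Definition test_function Omega u :=
  [/\ smooth u, compact (tsupport u) & tsupport u `<=` Omega].

(* A function on Omega is represented by a function on R^n of which only the
   values on Omega matter. *)
Definition zero_ext Omega u : 'rV[R]_n -> R := patch (cst 0) Omega u.

Definition L2 Omega u := zero_ext Omega u \in Lfun mu 2%:E.

Definition inner Omega u v : R := \int[mu]_(x in Omega) (u x * v x).

Definition L2_cvg Omega (f : nat -> 'rV[R]_n -> R) u :=
  Lnorm mu 2%:E (EFin \o zero_ext Omega (f m \- u)) @[m --> \oo] --> 0%E.

Definition weak_partial Omega (i : 'I_n) u g :=
  forall v, test_function Omega v ->
    inner Omega u (partial i v) = - inner Omega g v.

(* u is in H^1(Omega), with weak gradient G *)
Definition H1 Omega u G :=
  L2 Omega u /\ forall i, L2 Omega (G i) /\ weak_partial Omega i u (G i).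

(* u is in H^1_0(Omega), the closure of C_c^oo(Omega) in H^1(Omega), with weak
   gradient G *)
Definition H10 Omega u G :=
  H1 Omega u G /\
  exists f : nat -> 'rV[R]_n -> R,
    [/\ forall m, test_function Omega (f m),
        L2_cvg Omega f u &
        forall i, L2_cvg Omega (fun m => partial i (f m)) (G i)].

(* u is in H^1_0(Omega) and - Laplacian u = lambda u weakly *)
Definition dirichlet_eigen Omega (lambda : R) u :=
  exists2 G, H10 Omega u G &
    forall v, test_function Omega v ->
      \sum_(i < n) inner Omega (G i) (partial i v) = lambda * inner Omega u v.

(* Sequences are indexed from 1; the terms of index 0 play no role. As the phi j
   form a basis, the lambda j exhaust the Dirichlet spectrum, repeated according
   to multiplicity. *)
Definition dirichlet_eigenbasis Omega (lambda : nat -> R)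
    (phi : nat -> 'rV[R]_n -> R) :=
  [/\ 0 < lambda 1%N,
      forall i j, (1 <= i <= j)%N -> lambda i <= lambda j,
      lambda j @[j --> \oo] --> +oo &
   [/\ forall j, (1 <= j)%N -> dirichlet_eigen Omega (lambda j) (phi j),
      forall i j, (1 <= i)%N -> (1 <= j)%N ->
        inner Omega (phi i) (phi j) = (i == j)%:R &
      forall u, L2 Omega u ->
        L2_cvg Omega
          (fun m x => \sum_(1 <= j < m.+1) inner Omega u (phi j) * phi j x) u]].

End sobolev.

Section fourier.
Context {R : realType} {n : nat}.
Implicit Types (Omega : set 'rV[R]_n) (u : 'rV[R]_n -> R) (xi : 'rV[R]_n).

Local Notation mu := (lebesgue_rV R n).

Definition expi (t : R) : R[i] := (cos t +i* sin t)%C.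

Definition Cintegral (f : 'rV[R]_n -> R[i]) : R[i] :=
  (\int[mu]_(x in setT) complex.Re (f x) +i*
   \int[mu]_(x in setT) complex.Im (f x))%C.

Definition fourier u xi : R[i] :=
  ((2 * pi) `^ (- (n%:R / 2)))%:C%C *
    Cintegral (fun x => (u x)%:C%C * expi (- dot x xi)).

Definition fourier_density Omega (phi : nat -> 'rV[R]_n -> R) (k : nat) xi : R :=
  \sum_(1 <= j < k.+1) Normc.normc (fourier (zero_ext Omega (phi j)) xi) ^+ 2.

End fourier.

(* Main.v *)
Require Import Defs.
From HB Require Import structures.
From mathcomp Require Import all_boot all_order all_algebra.
From mathcomp Require Import complex ring.
From mathcomp Require Import all_classical all_reals all_analysis measurable_realfun.

(** The bound holds at every [xi]. Both terms of the minimum are instances of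
    Bessel's inequality on [Omega], tested against the plane wave
    [e_xi(x) = exp(- i x.xi)], split into its real and imaginary parts
    [cos (x.(-xi))] and [sin (x.(-xi))].

    The eigenfunctions are orthonormal, hence
    [sum_(j <= k) |<phi_j, e_xi>|^2 <= ||e_xi||^2 = V]
    ([bessel_eigenfunctions], [inner_coswave_sinwave]); up to the factor
    [(2 pi)^-n] the left-hand side is [F_k(xi)] ([sqr_normc_fourier]).

    The gradients [G_j] of the eigenfunctions satisfy
    [<G_i, G_j> = lambda_j delta_ij] in [L^2(Omega; R^n)]
    ([inner_gradients_eigen]), and testing them against the vector field
    [e_xi xi] gives [<G_j, e_xi xi> = c |xi|^2 <phi_j, e_xi>] with [|c| = 1],
    because elements of [H^1_0] integrate by parts against any wave, without
    boundary term ([inner_weak_gradient]). Bessel's inequality now reads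
    [sum_(j <= k) |xi|^4 |<phi_j, e_xi>|^2 / lambda_j <= |xi|^2 V], and
    [lambda_j <= lambda_k] yields the second bound ([bessel_gradients]).

    Waves are not compactly supported in [Omega], so they are not test
    functions for the weak gradient. The integration by parts is first
    done for the test functions that approximate [phi_j], where it reduces to
    [integral_partial_eq0]: the integral over [R^n] of a partial derivative of a
    compactly supported function vanishes. That is the fundamental theorem of
    calculus in the differentiated coordinate, combined with Fubini's theorem by
    induction on the dimension. Cauchy-Schwarz ([pairing_cvg]) carries the
    identity to the limit. *)

Import Order.TTheory GRing.Theory Num.Theory.
Import numFieldNormedType.Exports.

Local Open Scope classical_set_scope.
Local Open Scope ring_scope.

Set Implicit Arguments.
Unset Strict Implicit.
Unset Printing Implicit Defensive.

(** * The L^2 pairing and Bessel's inequality *)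

Section L2_pairing.
Context d (T : measurableType d) (R : realType).
Variable mu : {measure set T -> \bar R}.
Implicit Types f g h : T -> R.

Local Notation L2fun := (Lfun mu 2%:E).

Definition pairing f g : R := \int[mu]_x (f x * g x).

Lemma pairingC f g : pairing f g = pairing g f.
Proof. by apply: eq_Rintegral => x _; rewrite mulrC. Qed.

Lemma pairing_integrable f g : f \in L2fun -> g \in L2fun ->
  mu.-integrable setT (EFin \o (fun x => f x * g x)).
Proof. by move=> f2 g2; apply/Lfun1_integrable; exact: Lfun2_mul_Lfun1. Qed.

Lemma pairingBl f g h : f \in L2fun -> g \in L2fun -> h \in L2fun ->
  pairing (f - g) h = pairing f h - pairing g h.
Proof.
move=> f2 g2 h2; rewrite /pairing -RintegralB//; last 2 first.
- exact: pairing_integrable.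
- exact: pairing_integrable.
by apply: eq_Rintegral => x _; rewrite -mulrBl.
Qed.

Lemma pairingDl f g h : f \in L2fun -> g \in L2fun -> h \in L2fun ->
  pairing (f + g) h = pairing f h + pairing g h.
Proof.
move=> f2 g2 h2; rewrite /pairing -RintegralD//; last 2 first.
- exact: pairing_integrable.
- exact: pairing_integrable.
by apply: eq_Rintegral => x _; rewrite -mulrDl.
Qed.

Lemma pairingZl a f g : f \in L2fun -> g \in L2fun ->
  pairing (a *: f) g = a * pairing f g.
Proof.
move=> f2 g2; rewrite /pairing -RintegralZl//; last exact: pairing_integrable.
by apply: eq_Rintegral => x _; rewrite mulrA.
Qed.

Let ge1_2 : (1 <= 2%:E :> \bar R)%E. Proof. by rewrite lee1n. Qed.

Lemma Lfun2_0 : (0 : T -> R) \in L2fun.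
Proof. by have [] := @Lfun_submod_closed _ _ _ mu _ ge1_2. Qed.

Lemma Lfun2ZD a f g : f \in L2fun -> g \in L2fun -> a *: f + g \in L2fun.
Proof.
by have [_ h] := @Lfun_submod_closed _ _ _ mu _ ge1_2; exact: h.
Qed.

Lemma Lfun2Z a f : f \in L2fun -> a *: f \in L2fun.
Proof. by move=> f2; rewrite -[_ *: _]addr0 Lfun2ZD ?Lfun2_0. Qed.

Lemma Lfun2B f g : f \in L2fun -> g \in L2fun -> f - g \in L2fun.
Proof. by move=> f2 g2; rewrite addrC -scaleN1r Lfun2ZD. Qed.

Lemma Lfun2_lincomb (J : seq nat) (c : nat -> R) (F : nat -> T -> R) :
  {in J, forall j, F j \in L2fun} -> \sum_(j <- J) c j *: F j \in L2fun.
Proof.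
move=> F2; rewrite big_seq.
elim/big_ind : _ => [|f g f2 g2|j /F2 Fj]; first exact: Lfun2_0.
- by rewrite -[f]scale1r Lfun2ZD.
- exact: Lfun2Z.
Qed.

Lemma pairing_lincombl (J : seq nat) (c : nat -> R) (F : nat -> T -> R) g :
  {in J, forall j, F j \in L2fun} -> g \in L2fun ->
  pairing (\sum_(j <- J) c j *: F j) g = \sum_(j <- J) c j * pairing (F j) g.
Proof.
move=> + g2; elim: J => [_|j J IH F2].
  rewrite !big_nil /pairing; under eq_Rintegral do rewrite mul0r.
  by rewrite Rintegral_cst// mul0r.
have F2' : {in J, forall j, F j \in L2fun}.
  by move=> k kJ; apply: F2; rewrite inE kJ orbT.
have Fj : F j \in L2fun by apply: F2; rewrite mem_head.
rewrite !big_cons pairingDl// ?IH ?pairingZl//; first exact: Lfun2Z.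
exact: Lfun2_lincomb.
Qed.

(** With [b j = <F_j, E>] and [P] the sum of the [(b j / l j) F_j], the residual
    [E - P] is orthogonal to every [F_j], hence to [P], so that
    [0 <= ||E - P||^2 = <E, E> - <P, E>]. The index [i] ranges over the components
    of vector fields, and [l] is the diagonal of the Gram matrix: the family [F]
    is orthogonal without being normalized. *)
Lemma bessel (I : finType) (J : seq nat) (l : nat -> R)
    (F : nat -> I -> T -> R) (E : I -> T -> R) :
  uniq J ->
  {in J, forall j i, F j i \in L2fun} -> (forall i, E i \in L2fun) ->
  {in J, forall j, 0 < l j} ->
  {in J &, forall j j',
    \sum_i pairing (F j i) (F j' i) = l j * (j == j')%:R} ->
  \sum_(j <- J) (\sum_i pairing (F j i) (E i)) ^+ 2 / l j <=
  \sum_i pairing (E i) (E i).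
Proof.
move=> uJ F2 E2 l0 gram.
pose b j := \sum_i pairing (F j i) (E i).
pose c j := b j / l j.
pose P i := \sum_(j <- J) c j *: F j i.
have P2 i : P i \in L2fun by apply: Lfun2_lincomb => j jJ; exact: F2.
have EP2 i : E i - P i \in L2fun by exact: Lfun2B.
have PE j : j \in J -> \sum_i pairing (E i - P i) (F j i) = 0.
  move=> jJ.
  under eq_bigr => i _.
    rewrite pairingBl ?F2// pairing_lincombl ?F2//; last by move=> k /F2.
    over.
  rewrite big_split /= sumrN exchange_big /=.
  rewrite (eq_big_seq (fun k => if k == j then b j else 0)); last first.
    move=> k kJ; rewrite -mulr_sumr gram//; case: eqP => [->|]; last by rewrite !mulr0.
    by rewrite mulr1 /c divfK// gt_eqF// l0.
  rewrite (bigD1_seq j)//= eqxx [X in b j + X]big1 ?addr0; last first.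
    by move=> k /negbTE ->.
  by rewrite (eq_bigr _ (fun i _ => pairingC _ _)) subrr.
have PP : \sum_i pairing (E i - P i) (P i) = 0.
  under eq_bigr => i _.
    rewrite pairingC pairing_lincombl//; last by move=> k /F2.
    over.
  rewrite exchange_big /= big_seq big1// => j jJ.
  rewrite -mulr_sumr (eq_bigr _ (fun i _ => pairingC _ _)).
  by rewrite PE// mulr0.
have : 0 <= \sum_i pairing (E i - P i) (E i - P i).
  by apply: sumr_ge0 => i _; apply: Rintegral_ge0 => x _; rewrite -expr2 sqr_ge0.
under eq_bigr => i _.
  rewrite pairingBl// (pairingC (E i)) (pairingC (P i)).
  over.
rewrite big_split /= sumrN PP subr0.
under eq_bigr do rewrite pairingBl//.
rewrite big_split /= sumrN subr_ge0.
apply: le_trans.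
under [leRHS]eq_bigr => i _.
  rewrite pairing_lincombl//; last by move=> k /F2.
  over.
rewrite exchange_big /= le_eqVlt; apply/orP; left; apply/eqP/eq_bigr => j _.
by rewrite -mulr_sumr /c -/(b j) expr2 mulrAC.
Qed.

Lemma pairing_cauchy_schwarz f g : f \in L2fun -> g \in L2fun ->
  (`|pairing f g|%:E <= Lnorm mu 2%:E (EFin \o f) * Lnorm mu 2%:E (EFin \o g))%E.
Proof.
move=> f2 g2.
rewrite EFin_normr_Rintegral//; last exact: pairing_integrable.
have mfg := measurable_int mu (pairing_integrable f2 g2).
apply: le_trans (le_abse_integral _ _ _) _ => //.
apply: le_trans; last first.
  apply: (@hoelder _ _ _ _ _ _ 2 2) => //; last by rewrite [RHS]splitr !div1r.
  - by move: f2; rewrite inE => /andP[/[!inE]].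
  - by move: g2; rewrite inE => /andP[/[!inE]].
by rewrite Lnorm1.
Qed.

(** Cauchy-Schwarz bounds the error by [||f_ m - f|| ||g||]. *)
Lemma pairing_cvg (f_ : nat -> T -> R) f g :
  (forall m, f_ m \in L2fun) -> f \in L2fun -> g \in L2fun ->
  Lnorm mu 2%:E (EFin \o (f_ m - f)) @[m --> \oo] --> 0%E ->
  pairing (f_ m) g @[m --> \oo] --> pairing f g.
Proof.
move=> fm2 f2 g2 cvf.
have Nfin (h : T -> R) : h \in L2fun -> Lnorm mu 2%:E (EFin \o h) \is a fin_num.
  move=> h2; rewrite ge0_fin_numE ?Lnorm_ge0//.
  by move: h2; rewrite inE => /andP[_]; rewrite inE.
pose C := fine (Lnorm mu 2%:E (EFin \o g)).
pose e m := fine (Lnorm mu 2%:E (EFin \o (f_ m - f))).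
have e0 : e m * C @[m --> \oo] --> 0.
  rewrite -[X in _ --> X](mul0r C); apply: cvgM; last exact: cvg_cst.
  exact: (@fine_cvg _ _ _ _ _ 0).
apply/subr_cvg0/norm_cvg0P.
apply: (@squeeze_cvgr _ _ _ _ (fun=> 0) (fun m => e m * C)) => //; last first.
  exact: cvg_cst.
apply: nearW => m; rewrite normr_ge0 /=.
rewrite -lee_fin EFinM !fineK ?Nfin ?Lfun2B//.
by rewrite -pairingBl//; apply: pairing_cauchy_schwarz => //; exact: Lfun2B.
Qed.

End L2_pairing.

(** * Bounded functions living on a set of finite measure *)

Section bounded_functions.
Context d (T : measurableType d) (R : realType).
Variable mu : {measure set T -> \bar R}.

Lemma bounded_support_integrable (A : set T) (g : T -> R) (B : R) :
  measurable A -> (mu A < +oo)%E -> measurable_fun setT g ->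
  (forall x, `|g x| <= B) -> (forall x, ~ A x -> g x = 0) ->
  mu.-integrable setT (EFin \o g).
Proof.
move=> mA Afin mg gB g0.
have -> : g = g \_ A.
  apply/funext => x; rewrite patchE; case: ifPn => //.
  by rewrite notin_setE => /g0.
rewrite -restrict_EFin; apply/(integrable_mkcond _ mA).
apply: measurable_bounded_integrable => //; first exact: measurable_funTS.
exists B; split; first exact: num_real.
by move=> M BM x _; exact: le_trans (gB x) (ltW BM).
Qed.

Lemma bounded_support_Lfun2 (A : set T) (g : T -> R) (B : R) :
  measurable A -> (mu A < +oo)%E -> measurable_fun setT g ->
  (forall x, `|g x| <= B) -> (forall x, ~ A x -> g x = 0) ->
  g \in Lfun mu 2%:E.
Proof.
move=> mA Afin mg gB g0.
have /integrableP[_ ig] : mu.-integrable setT (EFin \o (fun x => g x ^+ 2)).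
  apply: (@bounded_support_integrable A _ (B ^+ 2)) => //.
  - exact: measurable_funX.
  - by move=> x; rewrite normrX lerXn2r ?nnegrE// (le_trans _ (gB x)).
  - by move=> x /g0 ->; rewrite expr0n.
rewrite inE; apply/andP; split; rewrite inE//= /finite_norm unlock /Lnorm.
apply: poweR_lty; apply: le_lt_trans ig.
rewrite le_eqVlt; apply/orP; left; apply/eqP/eq_integral => x _ /=.
by rewrite powR_mulrn// -normrX.
Qed.

End bounded_functions.

(** * Functions supported in a cube *)

Section box.
Context {R : realType} {n : nat}.
Implicit Types (M : R) (x : 'rV[R]_n).
Local Notation mu := (lebesgue_rV R n).

Definition box M : set 'rV[R]_n := [set x | forall i, - M <= x ord0 i <= M].

Lemma compact_box M : compact (box M).
Proof.
have := @rV_compact R n (fun=> `[- M, M]%classic) (fun=> @segment_compact _ _ _).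
by congr compact; apply/seteqP; split=> x /= h i; have := h i; rewrite in_itv.
Qed.

Lemma closed_box M : closed (box M).
Proof.
by apply: compact_closed; [exact: norm_hausdorff|exact: compact_box].
Qed.

Lemma measurable_box M : measurable (box M).
Proof.
rewrite -[box M]setCK; apply: measurableC; apply: open_measurable_rV.
exact/closed_openC/closed_box.
Qed.

(** The volume formula for boxes needs ordered bounds, so a negative [M] is
    replaced by its absolute value. *)
Lemma lebesgue_box_lty M : (mu (box M) < +oo)%E.
Proof.
apply: (@le_lt_trans _ _ (mu (box `|M|))).
  apply: le_measure; rewrite ?inE; [exact: measurable_box..|].
  by move=> x h i; rewrite -ler_norml (le_trans _ (ler_norm M))// ler_norml.
have := @lebesgue_rV_box R n (const_mx (- `|M|)) (const_mx `|M|).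
rewrite (_ : [set x : 'rV[R]_n | _] = box `|M|); last first.
  by apply/seteqP; split=> x h i; have := h i; rewrite !mxE.
by move=> ->; [rewrite ltry|move=> i; rewrite !mxE lerNl (le_trans _ (normr_ge0 M))// oppr_le0].
Qed.

Lemma compact_sub_box (K : set 'rV[R]_n) : compact K -> exists M, K `<=` box M.
Proof.
move=> /compact_bounded[M [_ KM]]; exists (M + 1) => x Kx i.
rewrite -ler_norml (le_trans _ (KM (M + 1) _ x Kx))//; last by rewrite ltrDl.
rewrite [leRHS]/Num.norm /= mx_normrE; apply/bigmax_geP; right => /=.
by exists (ord0, i).
Qed.

Lemma continuous_measurable_rV (f : 'rV[R]_n -> R) :
  continuous f -> measurable_fun setT f.
Proof.
move=> /continuousP cf; apply: (measurability _ (RGenOpens.measurableE R)).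
move=> _ [_ [a [b ->] <-]]; rewrite setTI; apply: open_measurable_rV.
exact/cf/interval_open.
Qed.

Lemma continuous_box_bounded M (f : 'rV[R]_n -> R) :
  continuous f -> (forall x, ~ box M x -> f x = 0) ->
  exists B, forall x, `|f x| <= B.
Proof.
move=> cf f0.
have /compact_bounded[B [_ fB]] : compact (f @` box M).
  apply: continuous_compact; last exact: compact_box.
  exact: continuous_subspaceT.
exists (`|B| + 1) => x; have [bx|nbx] := pselect (box M x); last first.
  by rewrite f0// normr0 addr_ge0.
apply: fB; last by exists x.
by rewrite (le_lt_trans (ler_norm B))// ltrDl.
Qed.

Lemma continuous_box_integrable M (f : 'rV[R]_n -> R) :
  continuous f -> (forall x, ~ box M x -> f x = 0) ->
  mu.-integrable setT (EFin \o f).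
Proof.
move=> cf f0; have [B fB] := continuous_box_bounded cf f0.
apply: (@bounded_support_integrable _ _ _ mu (box M) f B) => //.
- exact: measurable_box.
- exact: lebesgue_box_lty.
- exact: continuous_measurable_rV.
Qed.

Lemma partial_off_box M (i : 'I_n) (h : 'rV[R]_n -> R) x :
  (forall x, ~ box M x -> h x = 0) -> ~ box M x -> partial i h x = 0.
Proof.
move=> h0 nbx; rewrite /partial (@near_eq_derive _ _ _ h (cst 0)).
  exact: derive_cst.
have : \forall y \near x, (~` box M) y.
  by apply: open_nbhs_nbhs; split => //; exact/closed_openC/closed_box.
by apply: filterS => y /h0.
Qed.

End box.

(** * Integrals of partial derivatives *)

Section derive_along_line.
Context {R : realType} {U V W : normedModType R}.

(** A map [c] that turns translations along [v] into translations along [w]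
    identifies the difference quotients of [h \o c] and [h]. It serves for the
    slices of [R^(n+1)] and for the linear form [x |-> x.xi]. *)
Lemma derive_shift_comp (h : V -> W) (c : U -> V) (a v : U) (w : V) :
  (forall s : R, c (s *: v + a) = s *: w + c a) ->
  (derivable h (c a) w -> derivable (h \o c) a v) /\
  'D_v (h \o c) a = 'D_w h (c a).
Proof.
move=> cs; rewrite /derivable /derive.
have -> // : (fun s => s^-1 *: (((h \o c) \o shift a) (s *: v) - (h \o c) a)) =
          (fun s => s^-1 *: ((h \o shift (c a)) (s *: w) - h (c a))).
by apply/funext => s /=; rewrite cs.
Qed.

End derive_along_line.

Section integral_partial.
Context {R : realType}.

(** [F] vanishes near and beyond the end points of [[-b, b]] with [b = |M| + 1],
    so the integral over the line is [F b - F (- b) = 0]. *)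
Lemma integral_derive_eq0 (F : R -> R) (M : R) :
  (forall t, derivable F t 1) -> continuous (fun t => 'D_1 F t) ->
  (forall t, ~ - M <= t <= M -> F t = 0) ->
  (\int[lebesgue_measure]_t ('D_1 F t)%:E = 0)%E.
Proof.
move=> dF cF F0.
pose b := `|M| + 1.
have b0 : 0 < b by rewrite ltr_wpDl.
have FM t : b <= `|t| -> \forall s \near t, F s = 0.
  move=> bt.
  have Mt : `|M| < `|t| by rewrite (lt_le_trans _ bt)// ltrDl.
  have : \forall s \near t, `|M| < `|s|.
    exact: (cvgr_gt _ (@norm_continuous _ R^o t) _ Mt).
  apply: filterS => s Ms; apply: F0; rewrite -ler_norml => /(lt_le_trans Ms).
  by rewrite ltNge ler_norm.
have cF0 : continuous F.
  by move=> t; apply/differentiable_continuous/derivable1_diffP.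
have -> : (\int[lebesgue_measure]_t ('D_1 F t)%:E =
    \int[lebesgue_measure]_(t in `[(- b)%R, b%R]) ('D_1 F t)%:E)%E.
  rewrite [RHS]integral_mkcond; apply: eq_integral => t _.
  rewrite patchE; case: ifPn => //; rewrite notin_setE /= in_itv /= => tb.
  rewrite (@near_eq_derive _ _ _ F (cst 0)) ?derive_cst//.
  by apply: FM; rewrite leNgt; apply/negP => /ltW; rewrite ler_norml.
rewrite (@continuous_FTC2 _ _ F).
- by rewrite !(nbhs_singleton (FM _ _)) ?subee// ?normrN ger0_norm// ltW.
- by rewrite gtrN.
- exact: continuous_subspaceT.
- split.
  + by move=> t _; exact: dF.
  + exact/cvg_at_right_filter/cF0.
  + exact/cvg_at_left_filter/cF0.
- by move=> t _; rewrite derive1E.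
Qed.

Lemma continuous_row (T : topologicalType) m (f : T -> 'rV[R]_m) :
  (forall i, continuous (fun y => f y ord0 i)) -> continuous f.
Proof.
move=> cf y; apply/cvg_ballP => e e0.
have : \forall z \near y, forall i, ball (f y ord0 i) e (f z ord0 i).
  by apply: filter_forall => i; apply: cvg_ball => //; exact: cf.
by apply: filterS => z fz; split => // i j; rewrite (ord1 i).
Qed.

Section rV_cons.
Context {n : nat}.
Implicit Types (t s : R) (x y : 'rV[R]_n).

Lemma rV_cons_shiftl s t x :
  rV_cons (s *: (1 : R) + t, x) = s *: delta_mx ord0 ord0 + rV_cons (t, x).
Proof.
apply/rowP => i; rewrite !mxE; case: unliftP => [j ->|->] /=.
  by rewrite mulr0 add0r.
by [].
Qed.

Lemma rV_cons_shiftr s t x j : rV_cons (t, s *: delta_mx ord0 j + x) =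
  s *: delta_mx ord0 (lift ord0 j) + rV_cons (t, x).
Proof.
apply/rowP => i; rewrite !mxE; case: unliftP => [k ->|->] /=.
  by rewrite !mxE !eqxx/= (inj_eq lift_inj).
by rewrite mulr0 add0r.
Qed.

Lemma continuous_rV_consl x : continuous (fun t : R => rV_cons (t, x)).
Proof.
apply: continuous_row => i; under eq_fun do rewrite mxE.
by case: unliftP => [j _|_] /=; [exact: cst_continuous|move=> ?; exact: cvg_id].
Qed.

Lemma continuous_rV_consr t : continuous (fun x => rV_cons (t, x)).
Proof.
apply: continuous_row => i; under eq_fun do rewrite mxE.
case: unliftP => [j _|_] /=; [exact: coord_continuous|exact: cst_continuous].
Qed.

Lemma box_rV_cons M t x : box M (rV_cons (t, x)) -> - M <= t <= M /\ box M x.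
Proof.
move=> h; split; first by have := h ord0; rewrite mxE unlift_none.
by move=> i; have := h (lift ord0 i); rewrite mxE liftK.
Qed.

End rV_cons.

Section lebesgue_rV_step_integral.
Context {n : nat} (m : {sigma_finite_measure set 'rV[R]_n -> \bar R}).

(** The first factor is typed as the measurable space that carries the Lebesgue
    measure, so that the product set function is recognized as a measure. *)
Let P : {measure set (measurableTypeR R * 'rV[R]_n) -> \bar R} :=
  ((@lebesgue_measure R) \x m)%E.

Let measurable_cons :
  measurable_fun [set: measurableTypeR R * 'rV[R]_n] (@rV_cons R n).
Proof. exact: measurable_rV_cons. Qed.

Lemma integrable_lebesgue_rV_step (f : 'rV[R]_n.+1 -> \bar R) :
  (lebesgue_rV_step m).-integrable setT f -> P.-integrable setT (f \o rV_cons).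
Proof.
move=> /integrableP[mf foo]; apply/integrableP; split.
  exact: measurableT_comp.
apply: le_lt_trans foo; rewrite le_eqVlt; apply/orP; left; apply/eqP/esym.
apply: (@ge0_integral_pushforward _ _ _ _ R _ measurable_cons P setT
  (abse \o f)) => //.
  exact: measurableT_comp.
by move=> y _ /=; exact: abse_ge0.
Qed.

Lemma integral_lebesgue_rV_step (f : 'rV[R]_n.+1 -> \bar R) :
  (lebesgue_rV_step m).-integrable setT f ->
  (\int[lebesgue_rV_step m]_x f x = \int[P]_z f (rV_cons z))%E.
Proof.
move=> fi; have := integrable_lebesgue_rV_step fi.
have mf := measurable_int _ fi => fP.
exact: (@integral_pushforward _ _ _ _ R _ measurable_cons P setT f mf fP).
Qed.

End lebesgue_rV_step_integral.

(** Induction on the dimension along [rV_cons]. If [i] is the first coordinate,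
    that coordinate is integrated first, and the one-dimensional case applies to
    every line; otherwise the remaining coordinates are integrated first, and
    the induction hypothesis applies to every slice. *)
Lemma integral_partial_eq0 n (i : 'I_n) (h : 'rV[R]_n -> R) (M : R) :
  (forall x, derivable h x (delta_mx ord0 i)) -> continuous (partial i h) ->
  (forall x, ~ box M x -> h x = 0) ->
  (\int[lebesgue_rV R n]_x (partial i h x)%:E = 0)%E.
Proof.
elim: n => [|n IH] in i h *; first by case: i.
move=> dh cdh h0.
have intg : (lebesgue_rV R n.+1).-integrable setT (EFin \o partial i h).
  by apply: (@continuous_box_integrable _ _ M) => // x; exact: partial_off_box.
have intP := integrable_lebesgue_rV_step intg.
rewrite [LHS](integral_lebesgue_rV_step intg).
case: (unliftP ord0 i) => [j ij|i0].
  rewrite -(integral12_prod_meas1 intP) /=; apply: integral0_eq => t _ /=.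
  have dE x := @derive_shift_comp R 'rV[R]_n 'rV[R]_n.+1 _ h
    (fun x => rV_cons (t, x)) x _ _ (fun s => rV_cons_shiftr s t x j).
  rewrite -[RHS](IH j (fun x => h (rV_cons (t, x)))).
  - by apply: eq_integral => x _; rewrite /= /partial ij -(dE x).2.
  - by move=> x; apply: (dE x).1; rewrite -ij.
  - rewrite (_ : partial _ _ = fun x => partial i h (rV_cons (t, x))).
      move=> x; apply: continuous_comp; [exact: continuous_rV_consr|exact: cdh].
    by apply/funext => x; rewrite /= /partial ij -(dE x).2.
  - by move=> x nx; apply: h0 => /box_rV_cons[].
rewrite -(integral21_prod_meas1 intP) /=; apply: integral0_eq => x _ /=.
have dE t := @derive_shift_comp R R 'rV[R]_n.+1 _ h
  (fun t => rV_cons (t, x)) t 1 _ (fun s => rV_cons_shiftl s t x).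
rewrite -[RHS](@integral_derive_eq0 (fun t => h (rV_cons (t, x))) M).
- by apply: eq_integral => t _; rewrite /= /partial i0 -(dE t).2.
- by move=> t; apply: (dE t).1; rewrite -i0.
- rewrite [X in continuous X](_ : _ = fun t : R => partial i h (rV_cons (t, x))).
    move=> t; apply: (@continuous_comp _ _ _ (fun s : R => rV_cons (s, x))).
      exact: continuous_rV_consl.
    exact: cdh.
  by apply/funext => t; rewrite /= /partial i0 -(dE t).2.
- by move=> t nt; apply: h0 => /box_rV_cons[].
Qed.

End integral_partial.

(** * Test functions *)

Section test_functions.
Context {R : realType} {n : nat}.
Implicit Types (Omega : set 'rV[R]_n) (f u v w : 'rV[R]_n -> R).
Local Notation mu := (lebesgue_rV R n).
Local Notation L2fun := (Lfun mu 2%:E).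

Definition C1_along (i : 'I_n) w :=
  [/\ continuous w, forall x, derivable w x (delta_mx ord0 i) &
      continuous (partial i w)].

Lemma test_functionC1 Omega f i : test_function Omega f -> C1_along i f.
Proof.
by move=> [/(_ 1%N)[cf df] _ _]; split => //; [exact: (df i).1|exact: (df i).2.1].
Qed.

Lemma tsupport_eq0 f x : ~ tsupport f x -> f x = 0.
Proof.
by move=> nx; apply: contrapT => /eqP fx; apply: nx; exact: subset_closure.
Qed.

Lemma tsupport_partial_eq0 f i x : ~ tsupport f x -> partial i f x = 0.
Proof.
move=> nx; rewrite /partial (@near_eq_derive _ _ _ f (cst 0)).
  exact: derive_cst.
have : \forall y \near x, (~` tsupport f) y.
  by apply: open_nbhs_nbhs; split => //; exact/closed_openC/closed_closure.
by apply: filterS => y /tsupport_eq0.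
Qed.

Lemma zero_ext_id Omega u : (forall x, ~ Omega x -> u x = 0) ->
  zero_ext Omega u = u.
Proof.
move=> u0; apply/funext => x; rewrite /zero_ext patchE.
by case: ifPn => //; rewrite notin_setE => /u0.
Qed.

Lemma zero_ext_test Omega f : test_function Omega f -> zero_ext Omega f = f.
Proof.
move=> [_ _ sf]; apply: zero_ext_id => x nx.
by apply: tsupport_eq0 => /sf.
Qed.

Lemma zero_ext_partial_test Omega f i :
  test_function Omega f -> zero_ext Omega (partial i f) = partial i f.
Proof.
move=> [_ _ sf]; apply: zero_ext_id => x nx.
by apply: tsupport_partial_eq0 => /sf.
Qed.

Lemma test_function_box Omega f : test_function Omega f ->
  exists M, forall x, ~ box M x -> f x = 0.
Proof.
move=> [_ /compact_sub_box[M sM] _]; exists M => x nx.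
by apply: tsupport_eq0 => /sM.
Qed.

Lemma continuous_box_Lfun2 M f : continuous f ->
  (forall x, ~ box M x -> f x = 0) -> f \in L2fun.
Proof.
move=> cf f0; have [B fB] := continuous_box_bounded cf f0.
apply: (@bounded_support_Lfun2 _ _ _ mu (box M) f B) => //.
- exact: measurable_box.
- exact: lebesgue_box_lty.
- exact: continuous_measurable_rV.
Qed.

Lemma test_function_Lfun2 Omega f : test_function Omega f -> f \in L2fun.
Proof.
move=> tf; have [M f0] := test_function_box tf.
by apply: (@continuous_box_Lfun2 M) => //; have [/(_ 0%N)[]] := tf.
Qed.

Lemma test_function_partial_Lfun2 Omega f i :
  test_function Omega f -> partial i f \in L2fun.
Proof.
move=> tf; have [M f0] := test_function_box tf.
have [_ _ cdf] := test_functionC1 i tf.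
by apply: (@continuous_box_Lfun2 M) => // x; exact: partial_off_box.
Qed.

(** The product [f w] vanishes outside a cube, so its partial derivative has
    integral zero; Leibniz' rule splits it. *)
Lemma integration_by_parts_test Omega f i w :
  test_function Omega f -> C1_along i w ->
  pairing mu (partial i f) w = - pairing mu f (partial i w).
Proof.
move=> tf [cw dw cdw]; have [cf df cdf] := test_functionC1 i tf.
have [M f0] := test_function_box tf.
have pE x : partial i (f * w) x = partial i f x * w x + f x * partial i w x.
  by rewrite /partial deriveM// addrC mulrC.
have cM (u v : 'rV[R]_n -> R) : continuous u -> continuous v ->
    continuous (fun x => u x * v x).
  move=> cu cv x; apply: (@continuousM R 'rV[R]_n u v x); [exact: cu|exact: cv].
have int1 : mu.-integrable setT (EFin \o (fun x => partial i f x * w x)).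
  apply: (@continuous_box_integrable _ _ M); first exact: cM.
  by move=> x nx; rewrite (partial_off_box i f0 nx) mul0r.
have int2 : mu.-integrable setT (EFin \o (fun x => f x * partial i w x)).
  apply: (@continuous_box_integrable _ _ M); first exact: cM.
  by move=> x nx; rewrite f0// mul0r.
have cfw : continuous (partial i (f * w)).
  rewrite (_ : partial i (f * w) =
    (fun x => partial i f x * w x) \+ (fun x => f x * partial i w x)).
    move=> x; apply: (@continuousD R R 'rV[R]_n); first exact: cM.
    exact: cM.
  exact/funext.
have fw0 x : ~ box M x -> (f * w) x = 0.
  by move=> nx; rewrite /GRing.mul/= f0// mul0r.
have : \int[mu]_x partial i (f * w) x = 0.
  by have /(congr1 fine) :=
    integral_partial_eq0 (fun x => derivableM (df x) (dw x)) cfw fw0.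
under eq_Rintegral do rewrite pE.
by rewrite RintegralD// => /eqP; rewrite addr_eq0 => /eqP.
Qed.

End test_functions.

(** * Passing to the limit in H^1_0 *)

Section weak_limits.
Context {R : realType} {n : nat}.
Variable Omega : set 'rV[R]_n.
Implicit Types (f u v w : 'rV[R]_n -> R) (G : 'I_n -> 'rV[R]_n -> R).
Local Notation mu := (lebesgue_rV R n).
Local Notation L2fun := (Lfun mu 2%:E).

Lemma innerE u v :
  inner Omega u v = pairing mu (zero_ext Omega u) (zero_ext Omega v).
Proof.
rewrite /inner Rintegral_mkcond; apply: eq_Rintegral => x _.
by rewrite /zero_ext !patchE; case: ifPn => // _; rewrite mulr0.
Qed.

Lemma zero_extB u v :
  zero_ext Omega (u \- v) = zero_ext Omega u - zero_ext Omega v.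
Proof.
apply/funext => x.
rewrite /zero_ext /= patchE /GRing.add/= /GRing.opp/= !patchE.
by case: ifPn => // _; rewrite subr0.
Qed.

Lemma innerEl u v : inner Omega u v = pairing mu (zero_ext Omega u) v.
Proof.
rewrite /inner Rintegral_mkcond; apply: eq_Rintegral => x _.
by rewrite /zero_ext !patchE; case: ifPn => // _; rewrite mul0r.
Qed.

Lemma innerC u v : inner Omega u v = inner Omega v u.
Proof. by rewrite !innerE pairingC. Qed.

Lemma L2_cvg_inner (f : nat -> 'rV[R]_n -> R) u v :
  (forall m, L2 Omega (f m)) -> L2 Omega u -> L2 Omega v ->
  L2_cvg Omega f u -> inner Omega (f m) v @[m --> \oo] --> inner Omega u v.
Proof.
move=> f2 u2 v2 fu; rewrite innerE; under eq_fun do rewrite innerE.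
apply: pairing_cvg => //; move: fu; rewrite /L2_cvg.
by under eq_fun do rewrite zero_extB.
Qed.

(** No boundary term appears although [w] need not vanish on the boundary of
    [Omega]: the approximating test functions of [u] do, and both sides are
    continuous for the [H^1] norm of [u]. *)
Lemma inner_weak_gradient u G i w : H10 Omega u G -> C1_along i w ->
  L2 Omega w -> L2 Omega (partial i w) ->
  inner Omega (G i) w = - inner Omega u (partial i w).
Proof.
move=> [[u2 uG] [f [tf fu fG]]] cw w2 dw2.
have [Gi2 _] := uG i.
have h1 : inner Omega (partial i (f m)) w @[m --> \oo] --> inner Omega (G i) w.
  apply: L2_cvg_inner => // m; rewrite /L2 zero_ext_partial_test//.
  exact: test_function_partial_Lfun2 (tf m).
have h2 : inner Omega (f m) (partial i w) @[m --> \oo] -->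
    inner Omega u (partial i w).
  apply: L2_cvg_inner => // m; rewrite /L2 zero_ext_test//.
  exact: test_function_Lfun2 (tf m).
apply: (cvg_unique _ h1) => //.
rewrite (_ : (fun m => _) = fun m => - inner Omega (f m) (partial i w)).
  exact: cvgN.
apply/funext => m.
rewrite !innerEl zero_ext_partial_test// zero_ext_test//.
exact: integration_by_parts_test (tf m) cw.
Qed.

(** The weak eigenvalue equation is tested against the test functions that
    approximate [v]. With [u] and [v] eigenfunctions it gives the Gram matrix of
    the gradients. *)
Lemma inner_gradients_eigen lam u v G H :
  (forall i, L2 Omega (G i)) -> L2 Omega u ->
  (forall f, test_function Omega f ->
      \sum_(i < n) inner Omega (G i) (partial i f) = lam * inner Omega u f) ->
  H10 Omega v H ->
  \sum_(i < n) inner Omega (G i) (H i) = lam * inner Omega u v.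
Proof.
move=> G2 u2 eig [[v2 vH] [f [tf fv fH]]].
have h1 : \sum_(i < n) inner Omega (G i) (partial i (f m)) @[m --> \oo] -->
    \sum_(i < n) inner Omega (G i) (H i).
  apply: cvg_big => [|i _]; first exact: add_continuous.
  rewrite innerC; under eq_fun do rewrite innerC.
  apply: L2_cvg_inner => //; last exact: (vH i).1.
  move=> m; rewrite /L2 zero_ext_partial_test//.
  exact: test_function_partial_Lfun2 (tf m).
apply: (cvg_unique _ h1) => //.
rewrite (_ : (fun m => _) = fun m => lam * inner Omega u (f m)); last first.
  by apply/funext => m; exact: eig.
apply: cvgM; first exact: cvg_cst.
rewrite innerC; under eq_fun do rewrite innerC.
apply: L2_cvg_inner => // m; rewrite /L2 zero_ext_test//.
exact: test_function_Lfun2 (tf m).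
Qed.

End weak_limits.

(** * Plane waves *)

Section plane_waves.
Context {R : realType} {n : nat}.
Variable xi : 'rV[R]_n.

Definition coswave (x : 'rV[R]_n) : R := cos (dot x xi).
Definition sinwave (x : 'rV[R]_n) : R := sin (dot x xi).

Lemma continuous_dot : continuous (fun x : 'rV[R]_n => dot x xi).
Proof.
apply: continuous_big => [|i _ x]; first exact: add_continuous.
apply: (@continuousM R 'rV[R]_n (fun y => y ord0 i) (cst (xi ord0 i)) x).
  exact: coord_continuous.
exact: cst_continuous.
Qed.

Lemma dot_shift (i : 'I_n) (s : R) x :
  dot (s *: delta_mx ord0 i + x) xi = s *: xi ord0 i + dot x xi.
Proof.
rewrite /dot (bigD1 i)//= [in RHS](bigD1 i)//= !mxE !eqxx mulr1 mulrDl -addrA.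
congr (_ + (_ + _)); apply: eq_bigr => j ji.
by rewrite !mxE (negbTE ji) andbF mulr0 add0r.
Qed.

(** Moving [x] by [s] along the [i]-th axis moves [x.xi] by [s xi_i], and the
    derivative of [g] in the direction [xi_i] is [xi_i] times its derivative. *)
Lemma derive_wave (g : R -> R) (i : 'I_n) x : derivable g (dot x xi) 1 ->
  derivable (fun x => g (dot x xi)) x (delta_mx ord0 i) /\
  partial i (fun x => g (dot x xi)) x = xi ord0 i * 'D_1 g (dot x xi).
Proof.
move=> dg.
have [H1 H2] := @derive_shift_comp R 'rV[R]_n R _ g (fun x => dot x xi) x
  _ _ (fun s => dot_shift i s x).
have dfg : differentiable g (dot x xi) by exact/derivable1_diffP.
split; first by apply: H1; exact: diff_derivable.
rewrite /partial [LHS]H2 !deriveE//.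
rewrite (_ : xi ord0 i * _ = 'd g (dot x xi) (xi ord0 i *: (1 : R^o))).
  by congr ('d _ _ _); rewrite -[LHS]mulr1.
by rewrite linearZ.
Qed.

Lemma partial_coswave i : partial i coswave = (- xi ord0 i) *: sinwave.
Proof.
apply/funext => x.
rewrite (derive_wave i (@derivable_cos R _)).2 derive_val mulrN -mulNr.
by [].
Qed.

Lemma partial_sinwave i : partial i sinwave = xi ord0 i *: coswave.
Proof.
apply/funext => x.
by rewrite (derive_wave i (@derivable_sin R _)).2 derive_val.
Qed.

Lemma continuous_coswave : continuous coswave.
Proof.
by move=> x; apply: continuous_comp; [exact: continuous_dot|exact: continuous_cos].
Qed.

Lemma continuous_sinwave : continuous sinwave.
Proof.
by move=> x; apply: continuous_comp; [exact: continuous_dot|exact: continuous_sin].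
Qed.

Lemma C1_coswave i : C1_along i coswave.
Proof.
split; first exact: continuous_coswave.
  by move=> x; exact: (derive_wave i (@derivable_cos R _)).1.
rewrite partial_coswave => x; apply: (@continuousM R 'rV[R]_n (cst (- xi ord0 i)) sinwave x).
  exact: cst_continuous.
exact: continuous_sinwave.
Qed.

Lemma C1_sinwave i : C1_along i sinwave.
Proof.
split; first exact: continuous_sinwave.
  by move=> x; exact: (derive_wave i (@derivable_sin R _)).1.
rewrite partial_sinwave => x; apply: (@continuousM R 'rV[R]_n (cst (xi ord0 i)) coswave x).
  exact: cst_continuous.
exact: continuous_coswave.
Qed.

End plane_waves.

(** * Bessel's inequality for eigenfunctions and their gradients *)

Section density_bounds.
Context {R : realType} {n : nat}.
Variable Omega : set 'rV[R]_n.
Hypothesis oOmega : open Omega.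
Local Notation mu := (lebesgue_rV R n).
Hypothesis finOmega : (mu Omega < +oo)%E.
Implicit Types (u v w : 'rV[R]_n -> R).

Let mOmega : measurable Omega. Proof. exact: open_measurable_rV. Qed.

Lemma zero_extZ a u : zero_ext Omega (a *: u) = a *: zero_ext Omega u.
Proof.
apply/funext => x; rewrite /zero_ext [in RHS]/GRing.scale/= !patchE.
by case: ifPn => // _; rewrite scaler0.
Qed.

Lemma innerZr a u v : L2 Omega u -> L2 Omega v ->
  inner Omega u (a *: v) = a * inner Omega u v.
Proof.
by move=> u2 v2; rewrite !innerE zero_extZ pairingC pairingZl// pairingC.
Qed.

Lemma bounded_continuous_L2 w (B : R) :
  continuous w -> (forall x, `|w x| <= B) -> L2 Omega w.
Proof.
move=> cw wB; apply: (@bounded_support_Lfun2 _ _ _ mu Omega _ `|B|) => //.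
- apply: (measurable_restrictT w mOmega).1.
  exact: (measurable_funTS (continuous_measurable_rV cw)).
- move=> x; rewrite /zero_ext patchE; case: ifPn => _; last by rewrite normr0.
  exact: le_trans (wB x) (ler_norm B).
- by move=> x nx; rewrite /zero_ext patchE memNset.
Qed.

Lemma L2_coswave xi : L2 Omega (coswave xi).
Proof.
apply: (@bounded_continuous_L2 _ 1); first exact: continuous_coswave.
by move=> x; rewrite ler_norml cos_geN1 cos_le1.
Qed.

Lemma L2_sinwave xi : L2 Omega (sinwave xi).
Proof.
apply: (@bounded_continuous_L2 _ 1); first exact: continuous_sinwave.
by move=> x; rewrite ler_norml sin_geN1 sin_le1.
Qed.

(** The modulus of [e_xi] is [1]. *)
Lemma inner_coswave_sinwave xi :
  inner Omega (coswave xi) (coswave xi) + inner Omega (sinwave xi) (sinwave xi) =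
  fine (mu Omega).
Proof.
have c2 := L2_coswave xi; have s2 := L2_sinwave xi.
rewrite !innerE /pairing -RintegralD//; last 2 first.
- exact: pairing_integrable.
- exact: pairing_integrable.
rewrite -[RHS]mul1r -Rintegral_cst// [RHS]Rintegral_mkcond.
apply: eq_Rintegral => x _; rewrite /zero_ext !patchE.
by case: ifPn => _; rewrite ?mulr0 ?addr0// -!expr2 cos2Dsin2.
Qed.

Section eigenfunctions.
Variables (lambda : nat -> R) (phi : nat -> 'rV[R]_n -> R).
Variable G : nat -> 'I_n -> 'rV[R]_n -> R.
Hypothesis lambda_gt0 : 0 < lambda 1%N.
Hypothesis lambda_le : forall i j, (1 <= i <= j)%N -> lambda i <= lambda j.
Hypothesis phiG : forall j, (1 <= j)%N -> H10 Omega (phi j) (G j).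
Hypothesis phi_eigen : forall j, (1 <= j)%N ->
  forall v, test_function Omega v ->
    \sum_(i < n) inner Omega (G j i) (partial i v) =
    lambda j * inner Omega (phi j) v.
Hypothesis phi_orth : forall i j, (1 <= i)%N -> (1 <= j)%N ->
  inner Omega (phi i) (phi j) = (i == j)%:R.

Let phi_L2 j : (1 <= j)%N -> L2 Omega (phi j).
Proof. by move=> /phiG[[]]. Qed.

Let G_L2 j i : (1 <= j)%N -> L2 Omega (G j i).
Proof. by move=> /phiG[[_ /(_ i)[]]]. Qed.

Let lambda_pos j : (1 <= j)%N -> 0 < lambda j.
Proof. by move=> j1; rewrite (lt_le_trans lambda_gt0)// lambda_le// j1. Qed.

Lemma bessel_eigenfunctions k w : L2 Omega w ->
  \sum_(1 <= j < k.+1) inner Omega (phi j) w ^+ 2 <= inner Omega w w.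
Proof.
move=> w2.
have := @bessel _ _ _ mu 'I_1 (index_iota 1 k.+1) (fun=> 1)
  (fun j _ => zero_ext Omega (phi j)) (fun=> zero_ext Omega w).
rewrite big_ord1 -innerE => /(_ (iota_uniq _ _)) H.
rewrite (eq_bigr (fun j => (\sum_(i < 1) pairing mu (zero_ext Omega (phi j))
  (zero_ext Omega w)) ^+ 2 / 1)); last by move=> j _; rewrite big_ord1 divr1 innerE.
apply: H => //.
- by move=> j; rewrite mem_index_iota => /andP[/phi_L2].
- move=> j j'; rewrite !mem_index_iota => /andP[j1 _] /andP[j'1 _].
  by rewrite big_ord1 -innerE phi_orth// mul1r.
Qed.

(** Bessel's inequality for the gradients and the field [x |-> w(x) xi]. The
    waves [w] and [v] are conjugate: [(w, v)] will be [(cos, sin)] and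
    [(sin, - cos)], so that integrating by parts turns [<G_j, w xi>] into
    [|xi|^2 <phi_j, v>]. *)
Lemma bessel_gradients k (xi : 'rV[R]_n) w v : (1 <= k)%N ->
  L2 Omega w -> L2 Omega v -> (forall i, C1_along i w) ->
  (forall i, partial i w = (- xi ord0 i) *: v) ->
  dot xi xi * \sum_(1 <= j < k.+1) inner Omega (phi j) v ^+ 2 <=
  lambda k * inner Omega w w.
Proof.
move=> k1 w2 v2 cw dw.
have d0 : 0 <= dot xi xi by apply: sumr_ge0 => i _; rewrite -expr2 sqr_ge0.
have lk0 := lambda_pos k1.
have ww0 : 0 <= inner Omega w w.
  by apply: Rintegral_ge0 => x _; rewrite -expr2 sqr_ge0.
move: d0; rewrite le_eqVlt => /predU1P[<-|d0].
  by rewrite mul0r mulr_ge0// ltW.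
have := @bessel _ _ _ mu 'I_n (index_iota 1 k.+1) lambda
  (fun j i => zero_ext Omega (G j i))
  (fun i => xi ord0 i *: zero_ext Omega w) (iota_uniq _ _).
have -> : \sum_i pairing mu (xi ord0 i *: zero_ext Omega w)
    (xi ord0 i *: zero_ext Omega w) = dot xi xi * inner Omega w w.
  rewrite mulr_suml; apply: eq_bigr => i _.
  rewrite pairingZl ?Lfun2Z// pairingC pairingZl ?Lfun2Z//.
  by rewrite mulrA innerE.
have GE j : (1 <= j)%N ->
    \sum_i pairing mu (zero_ext Omega (G j i)) (xi ord0 i *: zero_ext Omega w) =
    dot xi xi * inner Omega (phi j) v.
  move=> j1; rewrite mulr_suml; apply: eq_bigr => i _.
  rewrite pairingC pairingZl//; last exact: G_L2.
  rewrite pairingC -innerE (inner_weak_gradient (phiG j1))//; last first.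
    by rewrite dw /L2 zero_extZ Lfun2Z.
  by rewrite dw innerZr ?phi_L2// mulNr opprK mulrA.
move=> H.
have {H} : \sum_(j <- index_iota 1 k.+1)
      (dot xi xi * inner Omega (phi j) v) ^+ 2 / lambda j <=
    dot xi xi * inner Omega w w.
  rewrite (eq_big_seq (fun j => (\sum_i pairing mu (zero_ext Omega (G j i))
    (xi ord0 i *: zero_ext Omega w)) ^+ 2 / lambda j)).
    apply: H.
    - by move=> j; rewrite mem_index_iota => /andP[j1 _] i; exact: G_L2.
    - by move=> i; exact: Lfun2Z.
    - by move=> j; rewrite mem_index_iota => /andP[/lambda_pos].
    - move=> j j'; rewrite !mem_index_iota => /andP[j1 _] /andP[j'1 _].
      rewrite -phi_orth// -(inner_gradients_eigen _ (phi_L2 j1) (phi_eigen j1) (phiG j'1)).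
        by apply: eq_bigr => i _; rewrite innerE.
      by move=> i; exact: G_L2.
  by move=> j; rewrite mem_index_iota => /andP[j1 _]; rewrite GE.
move=> H; rewrite -(ler_pM2l d0) mulrCA [leRHS]mulrCA -ler_pdivrMl//.
apply: le_trans H; rewrite !mulr_sumr big_seq [leRHS]big_seq.
apply: ler_sum => j; rewrite mem_index_iota => /andP[j1 jk].
rewrite [leLHS](_ : _ = (dot xi xi * inner Omega (phi j) v) ^+ 2 / lambda k);
  last by ring.
rewrite ler_wpM2l ?sqr_ge0//.
by rewrite lef_pV2 ?posrE ?lambda_pos// lambda_le// j1.
Qed.

End eigenfunctions.
End density_bounds.

(** * The modulus of the Fourier transform *)

Section fourier_modulus.
Context {R : realType} {n : nat}.
Local Notation mu := (lebesgue_rV R n).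

Lemma dotrN (x xi : 'rV[R]_n) : dot x (- xi) = - dot x xi.
Proof. by rewrite /dot -sumrN; apply: eq_bigr => i _; rewrite mxE mulrN. Qed.

(** The phase of the Fourier kernel is [x.(- xi)]; taking waves of frequency
    [- xi] absorbs the sign of the sine part. *)
Lemma sqr_normc_fourier (u : 'rV[R]_n -> R) xi :
  Normc.normc (fourier u xi) ^+ 2 =
  ((2 * pi) ^+ n)^-1 * (pairing mu u (coswave (- xi)) ^+ 2 +
                        pairing mu u (sinwave (- xi)) ^+ 2).
Proof.
have pi2 : 0 <= 2 * pi :> R by rewrite mulr_ge0// pi_ge0.
rewrite /fourier Normc.normcM exprMn; congr (_ * _).
  rewrite /= expr0n addr0 sqr_sqrtr ?sqr_ge0//.
  by rewrite -[LHS]powR_mulrn ?powR_ge0// -powRrM mulNr divfK// powRN powR_mulrn.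
rewrite /Cintegral /= sqr_sqrtr ?addr_ge0 ?sqr_ge0//.
congr (_ ^+ 2 + _ ^+ 2); apply: eq_Rintegral => x _ /=.
  by rewrite mul0r subr0 /coswave dotrN.
by rewrite mul0r addr0 /sinwave dotrN.
Qed.

End fourier_modulus.

(** * The Fourier density *)

Unset Implicit Arguments.

Theorem proposition3p1 (R : realType) (n : nat) (Omega : set 'rV[R]_n)
    (lambda : nat -> R) (phi : nat -> 'rV[R]_n -> R) :
  (2 <= n)%N ->
  open Omega ->
  (0 < lebesgue_rV R n Omega < +oo)%E ->
  dirichlet_eigenbasis Omega lambda phi ->
  forall k : nat, (1 <= k)%N ->
  {ae lebesgue_rV R n, forall xi : 'rV[R]_n,
    fourier_density Omega phi k xi <=
      fine (lebesgue_rV R n Omega) / (2 * pi) ^+ n *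
        (if xi == 0 then 1 else Num.min 1 (lambda k / enorm xi ^+ 2))}.
Proof.
move=> _ oOmega /andP[_ finOmega].
move=> [lambda1 lambda_le _ [eigen phi_orth _]] k k1.
(* At index 0, where nothing is assumed, G takes a dummy value. *)
have /choice[G GP] : forall j, exists G : 'I_n -> 'rV[R]_n -> R, (1 <= j)%N ->
    H10 Omega (phi j) G /\ forall v, test_function Omega v ->
      \sum_(i < n) inner Omega (G i) (partial i v) =
      lambda j * inner Omega (phi j) v.
  move=> j; have [/eigen[G GH Geig]|_] := boolP (1 <= j)%N.
    by exists G => _; split.
  by exists (fun=> cst 0).
have phiG j (j1 : (1 <= j)%N) := (GP j j1).1.
have phi_eigen j (j1 : (1 <= j)%N) := (GP j j1).2.
apply: aeW => xi.
pose V := fine (lebesgue_rV R n Omega).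
pose S := \sum_(1 <= j < k.+1) (inner Omega (phi j) (coswave (- xi)) ^+ 2 +
                                inner Omega (phi j) (sinwave (- xi)) ^+ 2).
have FS : fourier_density Omega phi k xi = ((2 * pi) ^+ n)^-1 * S.
  rewrite mulr_sumr; apply: eq_bigr => j _.
  by rewrite sqr_normc_fourier !innerEl.
have c2 := L2_coswave oOmega finOmega (- xi).
have s2 := L2_sinwave oOmega finOmega (- xi).
have SV : S <= V.
  rewrite /V -(inner_coswave_sinwave oOmega finOmega (- xi)) /S big_split.
  by apply: lerD; apply: (bessel_eigenfunctions phiG phi_orth).
(* The two parts of S come from the conjugate pairs (cos, sin), (sin, - cos). *)
have SlV : dot xi xi * S <= lambda k * V.
  have -> : dot xi xi = dot (- xi) (- xi).
    by apply: eq_bigr => i _; rewrite mxE mulrNN.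
  rewrite /V -(inner_coswave_sinwave oOmega finOmega (- xi)) /S big_split.
  rewrite /= !mulrDr addrC; apply: lerD.
    apply: (bessel_gradients lambda1 lambda_le phiG phi_eigen phi_orth k1) => //.
      by move=> i; exact: C1_coswave.
    by move=> i; exact: partial_coswave.
  have -> : \sum_(1 <= j < k.+1) inner Omega (phi j) (coswave (- xi)) ^+ 2 =
      \sum_(1 <= j < k.+1) inner Omega (phi j) (-1 *: coswave (- xi)) ^+ 2.
    apply: eq_big_nat => j /andP[/phiG[[phij _] _] _].
    by rewrite innerZr// mulN1r sqrrN.
  apply: (bessel_gradients lambda1 lambda_le phiG phi_eigen phi_orth k1) => //.
  - by rewrite /L2 zero_extZ Lfun2Z.
  - by move=> i; exact: C1_sinwave.
  - by move=> i; rewrite partial_sinwave scalerA mulrN1 opprK.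
have V0 : 0 <= V by rewrite fine_ge0.
rewrite FS -/V [V / _]mulrC -mulrA ler_wpM2l ?invr_ge0 ?exprn_ge0//.
  by rewrite mulr_ge0// pi_ge0.
case: eqVneq => [_|xi0]; first by rewrite mulr1.
have d0 : 0 < dot xi xi.
  have sq0 i : 0 <= xi ord0 i * xi ord0 i by rewrite -expr2 sqr_ge0.
  rewrite lt_def sumr_ge0 ?andbT//; apply: contraNneq xi0 => /eqP.
  rewrite psumr_eq0// => /allP h; apply/eqP/rowP => i.
  have := h i (mem_index_enum _).
  by rewrite /= mulf_eq0 orbb mxE => /eqP.
have -> : enorm xi ^+ 2 = dot xi xi by rewrite sqr_sqrtr// ltW.
rewrite /Num.min; case: ifP => _; first by rewrite mulr1.
by rewrite mulrA ler_pdivlMr// mulrC [V * _]mulrC.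
Qed.
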